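(* Let $\alpha_+:\mathrm{QSym}\to\mathrm{QSym}$ be the linear map with $\alpha_+(M_I)=M_{I\sqcup(1)}$ for every composition $I$ (where $I\sqcup(1)$ appends a final part $1$). Then for every monomial $u$ of $\mathcal{H}_K$ (a forest of rooted trees, including $u=1$), $Z^*(B_+(u))=\alpha_+(Z^*(u))$. Moreover, if $f:\mathcal{H}_K\to\mathrm{QSym}$ is any algebra homomorphism with $f(B_+(u))=\alpha_+(f(u))$ for every monomial $u$ of $\mathcal{H}_K$, then $f=Z^*$.
   Context: $k$ is a field of characteristic $0$. $\mathrm{QSym}$ is the algebra of quasi-symmetric functions over $k$ (formal power series of bounded degree in $x_1,x_2,\dots$ whose coefficients of $x_{n_1}^{i_1}\cdots x_{n_k}^{i_k}$ and $x_1^{i_1}\cdots x_k^{i_k}$ agree whenever $n_1<\dots<n_k$), with basis $M_I=\sum_{n_1<\dots<n_k}x_{n_1}^{i_1}\cdots x_{n_k}^{i_k}$ for compositions $I=(i_1,\dots,i_k)$, $M_\emptyset=1$, and coproduct $\Delta(M_K)=\sum_{I\sqcup J=K}M_I\otimes M_J$ ($\sqcup$ = juxtaposition). $\mathrm{NSym}=k\langle E_1,E_2,\dots\rangle$ is the free associative algebra ($\deg E_i=i$) with $\Delta(E_n)=\sum_{i+j=n}E_i\otimes E_j$, $E_0=1$; $E_I=E_{i_1}\cdots E_{i_l}$; $\mathrm{NSym}$ and $\mathrm{QSym}$ are paired by $\langle E_I,M_J\rangle=\delta_{I,J}$. A rooted tree is a finite poset with a unique maximal element (root) such that for each vertex the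 set of vertices exceeding it is a chain; $|t|$ is its number of vertices and $\mathrm{Sym}(t)$ its automorphism group. For a forest (commutative monomial of rooted trees) $t_1\cdots t_k$, $B_+(t_1\cdots t_k)$ is the rooted tree obtained by adjoining a new root whose children are the roots of $t_1,\dots,t_k$; $B_+(1)=\bullet$ (one vertex); $B_-$ is the inverse bijection. $k\mathcal{T}$ is the vector space with basis the rooted trees, with Grossman–Larson product $\circ$: for $t=B_+(t_1\cdots t_n)$ and $t'$ with $m$ vertices, $t\circ t'$ is the sum of the $m^n$ trees obtained by attaching each $t_i$ to some vertex of $t'$ (root of $t_i$ becoming a child of that vertex), and $\bullet\circ t'=t'$. Inner product on $k\mathcal{T}$: $(t,t')=|\mathrm{Sym}(t)|\delta_{t,t'}$. $\mathcal{H}_K$ is the free commutative algebra on rooted trees (Connes–Kreimer Hopf algebra, with coproduct $\Delta(t)=t\otimes1+(\mathrm{id}\otimes B_+)\Delta(B_-(t))$ extended multiplicatively). $k\mathcal{T}$ and $\mathcal{H}_K$ are paired by $\langle t,u\rangle=(t,B_+(u))$ for rooted trees $t$ and forests $u$. Let $\kappa_n=\sum_{t:\,|t|=n+1}t/|\mathrm{Sym}(t)|$, $\epsilon_0=\bullet$, $\epsilon_n=\kappa_1\circ\epsilon_{n-1}-\kappa_2\circ\epsilon_{n-2}+\dots+(-1)^{n-1}\kappa_n$. $Z:\mathrm{NSym}\to k\mathcal{T}$ is the algebra homomorphism (for $\circ$) with $Z(E_n)=\epsilon_n$, and $Z^*:\mathcal{H}_K\to\mathrm{QSym}$ is the dual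 map defined by $\langle P,Z^*(u)\rangle=\langle Z(P),u\rangle$ for all $P\in\mathrm{NSym}$, $u\in\mathcal{H}_K$. *)

(* Defs.v *)
From mathcomp Require Import all_boot all_order all_algebra.
Set Implicit Arguments. Unset Strict Implicit. Unset Printing Implicit Defensive.
Import GRing.Theory.
Local Open Scope ring_scope.

(* Rooted trees.  A rooted tree is represented by a planar tree; the    *)
(* vertices are addresses (seq nat), the root is [::], and the poset    *)
(* order is "w <= v iff v is a prefix of w" (ancestors are larger, the  *)
(* root is the unique maximal element).  Two planar trees represent the *)
(* same rooted tree iff the posets of vertices are isomorphic (iso).    *)
Inductive tree := Node of seq tree.

Definition children (t : tree) : seq tree := let: Node ts := t in ts.

Fixpoint vertices (t : tree) : seq (seq nat) :=
  let: Node ts := t in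
  [::] :: (fix go (i : nat) (ts : seq tree) : seq (seq nat) :=
             match ts with
             | [::] => [::]
             | c :: cs => map (cons i) (vertices c) ++ go i.+1 cs
             end) 0%N ts.

Definition tsize (t : tree) : nat := size (vertices t).

(* ws (listed in the same order as vs) is the image of vs under an
   order-preserving-and-reflecting map v_i |-> w_i *)
Definition preserves (vs ws : seq (seq nat)) : bool :=
  all (fun i => all (fun j =>
    prefix (nth [::] vs i) (nth [::] vs j) == prefix (nth [::] ws i) (nth [::] ws j))
    (iota 0 (size vs))) (iota 0 (size vs)).

Definition iso (t s : tree) : bool :=
  (tsize t == tsize s) && has (preserves (vertices t)) (permutations (vertices s)).

Definition aut (t : tree) : nat :=
  count (preserves (vertices t)) (permutations (vertices t)).

Definition bullet : tree := Node [::].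

(* B_+ of a forest u (a monomial of H_K, list of trees) is Node u. *)

Fixpoint graft (a : seq nat) (t c : tree) {struct a} : tree :=
  match a, t with
  | [::], Node ts => Node (rcons ts c)
  | i :: a', Node ts =>
      Node [seq (if p.1 == i then graft a' p.2 c else p.2) | p <- zip (iota 0 (size ts)) ts]
  end.

Fixpoint choices (n : nat) (V : seq (seq nat)) : seq (seq (seq nat)) :=
  if n is n'.+1 then flatten [seq [seq v :: cs | cs <- choices n' V] | v <- V]
  else [:: [::]].

(* Grossman--Larson product of two trees: the list of the m^n trees
   obtained by attaching each child of t to some vertex of t'. *)
Definition gl_tt (t t' : tree) : seq tree :=
  [seq foldl (fun s pc => graft pc.1 s pc.2) t' (zip cs (children t))
  | cs <- choices (size (children t)) (vertices t')].

Fixpoint forests (fuel M : nat) : seq (seq tree) :=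
  if fuel is f.+1 then
    (if M == 0%N then [:: [::]] else
       flatten [seq flatten [seq [seq Node c :: r | r <- forests f (M - j)]
                             | c <- forests f j.-1] | j <- iota 1 M])
  else [::].

Definition trees_of_size (N : nat) : seq tree :=
  if N is N'.+1 then [seq Node c | c <- forests N N'] else [::].

Fixpoint dedup_iso (acc l : seq tree) : seq tree :=
  match l with
  | [::] => rev acc
  | t :: l' => if has (iso t) acc then dedup_iso acc l' else dedup_iso (t :: acc) l'
  end.

Section KT.
Variable k : fieldType.

(* Elements of kT: finite formal k-linear combinations of trees. *)
Definition kT := seq (k * tree).

Definition scaleT (c : k) (x : kT) : kT := [seq (c * p.1, p.2) | p <- x].

Definition glmul (x y : kT) : kT :=
  flatten [seq flatten [seq [seq (p.1 * q.1, s) | s <- gl_tt p.2 q.2] | q <- y] | p <- x].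

Definition coefT (x : kT) (s : tree) : k := \sum_(p <- x | iso p.2 s) p.1.

Definition kappa (n : nat) : kT :=
  [seq (((aut t)%:R)^-1, t) | t <- dedup_iso [::] (trees_of_size n.+1)].

Fixpoint epsl (n : nat) : seq kT :=
  match n with
  | 0%N => [:: [:: (1, bullet)]]
  | n'.+1 =>
      let l := epsl n' in
      rcons l (flatten [seq scaleT ((-1) ^+ i.-1) (glmul (kappa i) (nth [::] l (n'.+1 - i)))
                       | i <- iota 1 n'.+1])
  end.

Definition eps (n : nat) : kT := nth [::] (epsl n) n.

Definition ZE (I : seq nat) : kT := foldr (fun i acc => glmul (eps i) acc) [:: (1, bullet)] I.

(* pairing <x, u> = (x, B_+(u)) with (t,t') = |Sym t| delta_{t,t'} *)
Definition pairT (x : kT) (u : seq tree) : k := coefT x (Node u) * (aut (Node u))%:R.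

(* Formal power series in x_1, x_2, ...: a series is given by its       *)
(* coefficients F a, where a : seq nat is an exponent vector            *)
(* (x_1^{a_1} x_2^{a_2} ...).                                           *)
Definition series := seq nat -> k.

Definition compr (a : seq nat) : seq nat := [seq i <- a | (0 < i)%N].

Definition is_qsym (F : series) : Prop :=
  (forall a, F a = F (compr a)) /\ (exists d, forall a, (d < sumn a)%N -> F a = 0).

(* M_I as a series; F in QSym equals sum_I F(I) M_I *)
Definition Mbasis (I : seq nat) : series := fun a => (compr a == I)%:R.

Definition ser1 : series := fun a => (sumn a == 0%N)%:R.

Definition boxes (a : seq nat) : seq (seq nat) :=
  foldr (fun ai acc => flatten [seq [seq j :: b | b <- acc] | j <- iota 0 ai.+1]) [:: [::]] a.

Definition sermul (F G : series) : series := fun a =>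
  \sum_(b <- boxes a) F b * G [seq (p.1 - p.2)%N | p <- zip a b].

(* alpha_+ : linear extension of M_I |-> M_{I ++ [:: 1]} *)
Definition alpha (F : series) : series := fun a =>
  let c := compr a in if last 0%N c == 1%N then F (take (size c).-1 c) else 0.

(* Z^*(u): the element of QSym with <E_I, Z^*(u)> = <Z(E_I), u>, i.e.
   whose coefficient on M_I is <Z(E_I), u>. *)
Definition Zstar (u : seq tree) : series := fun a => pairT (ZE (compr a)) u.

End KT.

(* Main.v *)
Require Import Defs.
From HB Require Import structures.
From mathcomp Require Import all_boot all_order all_algebra.
Set Implicit Arguments. Unset Strict Implicit. Unset Printing Implicit Defensive.

(* The Grossman-Larson product is dual to admissible cuts:
   <x o y, u> is the sum of <x, P> <y, R> over the cuts of the forest u into a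
   pruned part P and a trunk R.  Since <kappa_n, u> = 1 for every forest u with
   n vertices, a sign-reversing argument on cuts shows that <eps_n, u> is 1 if
   u consists of n one-vertex trees and 0 otherwise.  Hence <Z(E_I), u> counts
   the ways to strip off u successive layers of i_1, i_2, ... leaves.  The last
   layer of B_+(u) is its root alone, which gives the intertwining with alpha_+,
   and layers of a disjoint union are disjoint unions of layers, which gives
   multiplicativity.  Uniqueness is clear, as every forest is built from the
   empty one by products and B_+. *)

(** * Induction principles and decidable equality for trees *)

Lemma tree_nested_ind (P : tree -> Prop) :
  (forall ts, foldr (fun t Q => P t /\ Q) True ts -> P (Node ts)) -> forall t, P t.
Proof.
move=> H; fix IH 1; case=> ts; apply: H.
by elim: ts => [//|t ts IHts]; split; [exact: IH | exact: IHts].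
Qed.

(** An embedding into the generic trees of the library, which transports their decidable equality;
    the node label [0] is a dummy. *)
Fixpoint gen_of_tree (t : tree) : GenTree.tree nat :=
  let: Node ts := t in GenTree.Node 0 (map gen_of_tree ts).
Fixpoint tree_of_gen (g : GenTree.tree nat) : tree :=
  if g is GenTree.Node _ gs then Node (map tree_of_gen gs) else Node [::].
Lemma gen_of_treeK : cancel gen_of_tree tree_of_gen.
Proof.
elim/tree_nested_ind => ts IH /=; congr Node.
by elim: ts IH => //= t ts IHts [-> /IHts ->].
Qed.
HB.instance Definition _ := Equality.copy tree (can_type gen_of_treeK).

Lemma tree_ind_mem (P : tree -> Prop) :
  (forall ts, {in ts, forall t, P t} -> P (Node ts)) -> forall t, P t.
Proof.
move=> H; elim/tree_nested_ind => ts IH; apply: H => t.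
elim: ts IH => //= s ts IHts [Ps /IHts IH].
by rewrite inE => /predU1P[-> //|]; apply: IH.
Qed.

(** * Permanents *)

(* [picks s] lists each entry of [s] together with the remaining entries;
   [permanent] is then the row expansion of the permanent of [K t s]. *)
Fixpoint picks (T : Type) (s : seq T) : seq (T * seq T) :=
  if s is x :: s' then (x, s') :: [seq (p.1, x :: p.2) | p <- picks s'] else [::].

Fixpoint permanent (T U : Type) (K : T -> U -> nat) (ts : seq T) (ss : seq U) : nat :=
  if ts is t :: ts' then \sum_(p <- picks ss) K t p.1 * permanent K ts' p.2
  else nilp ss.

Lemma picks_map (T U : Type) (f : T -> U) (s : seq T) :
  picks (map f s) = [seq (f p.1, map f p.2) | p <- picks s].
Proof. by elim: s => //= x s ->; rewrite -!map_comp. Qed.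

Lemma picks_cat (T : Type) (s1 s2 : seq T) :
  picks (s1 ++ s2) = [seq (p.1, p.2 ++ s2) | p <- picks s1]
                  ++ [seq (p.1, s1 ++ p.2) | p <- picks s2].
Proof.
elim: s1 => [|x s1 IH] /=; first by rewrite -[LHS]map_id; apply/eq_map => -[].
by rewrite IH map_cat -!map_comp.
Qed.

Lemma picks_uniq (T : eqType) (s : seq T) :
  uniq s -> picks s = [seq (x, rem x s) | x <- s].
Proof.
elim: s => //= x s IH /andP[xs us]; rewrite eqxx IH // -map_comp; congr cons.
apply/eq_in_map => y ys /=; case: eqP => // xy.
by rewrite xy ys in xs.
Qed.

Lemma picks_perm (T : eqType) (s : seq T) p : p \in picks s -> perm_eq s (p.1 :: p.2).
Proof.
elim: s p => //= x s IH p; rewrite inE => /predU1P[-> //|/mapP[q /IH sq ->] /=].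
by rewrite perm_sym (perm_catCA [:: q.1] [:: x] q.2) perm_cons perm_sym.
Qed.

Lemma permanent_map T U T' U' (K : T' -> U' -> nat) (f : T -> T') (g : U -> U') ts ss :
  permanent K (map f ts) (map g ss) = permanent (fun t s => K (f t) (g s)) ts ss.
Proof.
elim: ts ss => [|t ts IH] ss /=; first by rewrite /nilp size_map.
by rewrite picks_map big_map; apply: eq_bigr => p _; rewrite IH.
Qed.

(** In the row expansion the first row either takes the column [s] or leaves it to the recursive
    call; exchanging sums gives the second kind of term the shape of a column expansion. *)
Lemma permanent_col T U (K : T -> U -> nat) ts s ss :
  permanent K ts (s :: ss) = \sum_(p <- picks ts) K p.1 s * permanent K p.2 ss.
Proof.
elim: ts s ss => [|t ts IH] s ss /=; first by rewrite big_nil.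
rewrite !big_cons !big_map /=; congr (_ + _).
under eq_bigr do rewrite IH big_distrr.
rewrite exchange_big; apply: eq_bigr => p _ /=.
by rewrite big_distrr; apply: eq_bigr => q _; rewrite mulnCA.
Qed.

Lemma permanent_sym T U (K : T -> U -> nat) ts ss :
  permanent K ts ss = permanent (fun s t => K t s) ss ts.
Proof.
elim: ss ts => [|s ss IH] ts; last first.
  by rewrite permanent_col /=; apply: eq_bigr => p _; rewrite IH.
by case: ts => //= t ts; rewrite big_nil.
Qed.

Fixpoint splits (T : Type) (s : seq T) : seq (seq T * seq T) :=
  if s is x :: s' then [seq (x :: p.1, p.2) | p <- splits s']
                    ++ [seq (p.1, x :: p.2) | p <- splits s']
  else [:: ([::], [::])].

(** Laplace expansion along a block of columns: each row is matched either inside [ss1] or inside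
    [ss2]. *)
Lemma permanent_cat T U (K : T -> U -> nat) ts ss1 ss2 :
  permanent K ts (ss1 ++ ss2)
  = \sum_(p <- splits ts) permanent K p.1 ss1 * permanent K p.2 ss2.
Proof.
elim: ts ss1 ss2 => [|t ts IH] ss1 ss2 /=.
  by rewrite big_seq1 /nilp size_cat addn_eq0 mulnb.
rewrite picks_cat !big_cat !big_map /=; congr (_ + _).
  under eq_bigr do rewrite IH big_distrr.
  rewrite exchange_big; apply: eq_bigr => p _ /=.
  by rewrite big_distrl; apply: eq_bigr => q _; rewrite mulnA.
under eq_bigr do rewrite IH big_distrr.
rewrite exchange_big; apply: eq_bigr => p _ /=.
by rewrite big_distrr; apply: eq_bigr => q _; rewrite mulnCA.
Qed.

Lemma splits_sym (T : Type) (s : seq T) (F : seq T -> seq T -> nat) :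
  \sum_(p <- splits s) F p.1 p.2 = \sum_(p <- splits s) F p.2 p.1.
Proof.
elim: s F => [|x s IH] F /=; first by rewrite !big_seq1.
rewrite !big_cat !big_map /= addnC.
by rewrite (IH (fun a b => F a (x :: b))) (IH (fun a b => F (x :: a) b)).
Qed.

Lemma permanent_catC T U (K : T -> U -> nat) ts ss1 ss2 :
  permanent K ts (ss1 ++ ss2) = permanent K ts (ss2 ++ ss1).
Proof.
rewrite !permanent_cat (splits_sym _ (fun a b => _ K a _ * _ K b _)).
by apply: eq_bigr => p _; rewrite mulnC.
Qed.

Lemma permanent_catCA T U (K : T -> U -> nat) ts ss1 ss2 ss3 :
  permanent K ts (ss1 ++ ss2 ++ ss3) = permanent K ts (ss2 ++ ss1 ++ ss3).
Proof.
rewrite !catA !(permanent_cat _ _ (_ ++ _)).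
by apply: eq_bigr => p _; rewrite permanent_catC.
Qed.

Lemma permanent_perm_cols T (U : eqType) (K : T -> U -> nat) ts ss1 ss2 :
  perm_eq ss1 ss2 -> permanent K ts ss1 = permanent K ts ss2.
Proof.
move/catCA_perm_ind => ind; apply: (ind (fun s => permanent K ts ss1 = permanent K ts s)) => //.
by move=> s1 s2 s3 ->; rewrite permanent_catCA.
Qed.

Lemma permanent_perm_rows (T : eqType) U (K : T -> U -> nat) ts1 ts2 ss :
  perm_eq ts1 ts2 -> permanent K ts1 ss = permanent K ts2 ss.
Proof. by rewrite !(permanent_sym K); apply: permanent_perm_cols. Qed.

(** * Order isomorphisms of rooted trees *)

(* Unlike [preserves], false on lists of different sizes. *)
Definition pres (vs ws : seq (seq nat)) : bool :=
  (size vs == size ws) &&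
  allrel (fun p q => prefix p.1 q.1 == prefix p.2 q.2) (zip vs ws) (zip vs ws).

(** Comparisons by position become comparisons of zipped pairs, which split along concatenations. *)
Lemma preservesE vs ws : size vs = size ws -> preserves vs ws = pres vs ws.
Proof.
move=> eqs; rewrite /pres eqs eqxx /=; apply/allP/allrelP => /= [H p q|H i].
  move=> /(nthP ([::], [::]))[i]; rewrite size_zip eqs minnn => im <-.
  move=> /(nthP ([::], [::]))[j]; rewrite size_zip eqs minnn => jm <-.
  have iI : i \in iota 0 (size vs) by rewrite mem_iota eqs.
  have jI : j \in iota 0 (size vs) by rewrite mem_iota eqs.
  by rewrite !nth_zip //=; move/allP: (H i iI) => /(_ j jI).
rewrite mem_iota /= ?eqs => im; apply/allP => j.
rewrite mem_iota /= ?eqs => jm.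
have M m : m < size ws -> (nth [::] vs m, nth [::] ws m) \in zip vs ws.
  by move=> lt; rewrite -nth_zip // mem_nth // size_zip eqs minnn.
exact: (H _ _ (M _ im) (M _ jm)).
Qed.

Definition isos (t s : tree) : seq (seq (seq nat)) :=
  [seq ws <- permutations (vertices s) | pres (vertices t) ws].

Definition niso (t s : tree) : nat := size (isos t s).

Lemma niso_aut t : aut t = niso t t.
Proof.
rewrite /niso size_filter; apply: eq_in_count => ws.
by rewrite mem_permutations => /perm_size /esym /preservesE.
Qed.

Lemma niso_gt0 t s : (0 < niso t s) = iso t s.
Proof.
rewrite /niso size_filter -has_count /iso.
case: eqP => /= eqs.
  apply: eq_in_has => ws; rewrite mem_permutations => /perm_size e.
  by rewrite preservesE //; apply: etrans eqs (esym e).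
apply/hasPn => ws; rewrite mem_permutations => /perm_size e.
by rewrite /pres; case: eqP => //= e'; case: eqs; apply: etrans e' e.
Qed.

(* Labelling the branches by their index makes the vertex addresses of a
   subforest stable when other branches are removed. *)
Fixpoint label (i : nat) (ts : seq tree) : seq (nat * tree) :=
  if ts is t :: ts' then (i, t) :: label i.+1 ts' else [::].

Definition fv (F : seq (nat * tree)) : seq (seq nat) :=
  flatten [seq map (cons p.1) (vertices p.2) | p <- F].

Lemma vertices_Node ts : vertices (Node ts) = [::] :: fv (label 0 ts).
Proof. by rewrite /=; congr cons; elim: ts 0 => //= t ts IH i; rewrite IH. Qed.

Lemma label_labels i ts : map fst (label i ts) = iota i (size ts).
Proof. by elim: ts i => //= t ts IH i; rewrite IH. Qed.

Lemma label_trees i ts : map snd (label i ts) = ts.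
Proof. by elim: ts i => //= t ts IH i; rewrite IH. Qed.

Lemma size_vertices t : 0 < size (vertices t).
Proof. by case: t. Qed.

Lemma root_in t : [::] \in vertices t.
Proof. by case: t => ts; rewrite vertices_Node mem_head. Qed.

Lemma mem_fv F a : reflect (exists2 p, p \in F & exists2 b, b \in vertices p.2 & a = p.1 :: b)
  (a \in fv F).
Proof.
apply: (iffP flatten_mapP) => -[p pF H]; exists p => //; first by case/mapP: H => b; exists b.
by case: H => b bv ->; rewrite map_f.
Qed.

Lemma pres_map_cons i j vs ws :
  pres (map (cons i) vs) (map (cons j) ws) = pres vs ws.
Proof.
rewrite /pres !size_map; congr andb.
have -> : zip (map (cons i) vs) (map (cons j) ws) = [seq (i :: p.1, j :: p.2) | p <- zip vs ws].
  by elim: vs ws => [|v vs IH] [|w ws] //=; rewrite IH.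
rewrite allrel_mapl allrel_mapr; apply: eq_allrel => p q /=.
by rewrite !eqxx.
Qed.

Lemma pres_prefix vs ws v w v' w' : pres vs ws ->
  (v, w) \in zip vs ws -> (v', w') \in zip vs ws -> prefix v v' = prefix w w'.
Proof. by case/andP=> _ /allrelP H /H{}H /H /eqP. Qed.

Definition fisos (F G : seq (nat * tree)) : seq (seq (seq nat)) :=
  [seq ws <- permutations (fv G) | pres (fv F) ws].

Lemma mem_zip_r (T U : eqType) (s : seq T) (r : seq U) y :
  size s = size r -> y \in r -> exists x, (x, y) \in zip s r.
Proof.
elim: s r => [|x s IH] [|z r] //= [e].
rewrite inE => /predU1P[->|/(IH _ e)[x' H]]; first by exists x; rewrite mem_head.
by exists x'; rewrite inE H orbT.
Qed.

Lemma mem_zip_l (T U : eqType) (s : seq T) (r : seq U) x :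
  size s = size r -> x \in s -> exists y, (x, y) \in zip s r.
Proof.
elim: s r => [|z s IH] [|y r] //= [e].
rewrite inE => /predU1P[->|/(IH _ e)[x' H]]; first by exists y; rewrite mem_head.
by exists x'; rewrite inE H orbT.
Qed.

Lemma mem_zip (T U : eqType) (s : seq T) (r : seq U) x y :
  (x, y) \in zip s r -> x \in s /\ y \in r.
Proof.
elim: s r => [|z s IH] [|w r] //=.
by rewrite !inE => /predU1P[[-> ->]|/IH[-> ->]]; rewrite ?eqxx ?orbT.
Qed.

Lemma isos_Node ts ss :
  isos (Node ts) (Node ss) =i map (cons [::]) (fisos (label 0 ts) (label 0 ss)).
Proof.
move=> w; apply/idP/mapP; rewrite mem_filter mem_permutations !vertices_Node.
  case/andP=> P pw; have szw : size ([::] :: fv (label 0 ts)) = size w.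
    by case/andP: P => /eqP.
  case: w szw P pw => // w0 w sz P pw.
  (* Some vertex [x] is sent to the root. It lies below the source root, so the image [w0] of that
     root is a prefix of [[::]]. *)
  have zP : ([::], w0) \in zip ([::] :: fv (label 0 ts)) (w0 :: w) by rewrite mem_head.
  have : [::] \in w0 :: w by rewrite (perm_mem pw) mem_head.
  case/(mem_zip_r sz) => x xP.
  have := pres_prefix P zP xP; rewrite prefix0s prefixs0 => /esym/eqP w00.
  rewrite w00 perm_cons in pw; exists w; last by rewrite w00.
  rewrite mem_filter mem_permutations pw andbT.
  case/andP: P => /eqP[e]; rewrite /= w00 /pres e eqxx allrel_consl allrel_consr.
  by case/and3P.
case=> u; rewrite mem_filter mem_permutations => /andP[P pu] ->.
rewrite perm_cons pu andbT /pres /=.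
case/andP: P => /eqP-> P; rewrite eqxx /=.
rewrite allrel_consl allrel_consr P andbT /=; apply/andP; split.
  by apply/allP => x _ /=; rewrite !prefix0s.
apply/allP => -[x y] /mem_zip[xF xu].
rewrite (perm_mem pu) in xu.
by case/mem_fv: xF => p _ [b _ ->]; case/mem_fv: xu => q _ [c _ ->].
Qed.

Lemma niso_fisos ts ss : niso (Node ts) (Node ss) = size (fisos (label 0 ts) (label 0 ss)).
Proof.
rewrite /niso -(size_map (cons [::]) (fisos _ _)); apply: perm_size; apply: uniq_perm.
- by rewrite filter_uniq // permutations_uniq.
- by rewrite map_inj_uniq ?filter_uniq ?permutations_uniq // => ? ? [].
exact: isos_Node.
Qed.

Lemma rem_label (G : seq (nat * tree)) q p :
  uniq (map fst G) -> q \in G -> p \in rem q G -> p.1 != q.1.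
Proof.
move=> uG qG pr; have := perm_map fst (perm_to_rem qG).
move/perm_uniq; rewrite uG /= => /esym/andP[/memPn H _].
by apply: H; rewrite map_f.
Qed.

Lemma fv_rem (G : seq (nat * tree)) q : q \in G ->
  perm_eq (fv G) (map (cons q.1) (vertices q.2) ++ fv (rem q G)).
Proof. by move=> qG; have := perm_flatten (perm_map _ (perm_to_rem qG)); apply. Qed.

Lemma prefix1 (i j : nat) b : prefix [:: i] (j :: b) = (i == j).
Proof. by rewrite /= prefix0s andbT. Qed.

(* The root of the first branch can only go to a root of [G], and its branch
   is then mapped onto the branch of that root. *)
Lemma fisos_consP i t F G ws : uniq (i :: map fst F) -> uniq (map fst G) ->
  reflect (exists q w1 w2, [/\ q \in G, w1 \in isos t q.2, w2 \in fisos F (rem q G)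
                            & ws = map (cons q.1) w1 ++ w2])
    (ws \in fisos ((i, t) :: F) G).
Proof.
move=> /= /andP[/memPn iF uF] uG; apply: (iffP idP); last first.
  case=> q [w1 [w2 [qG]]]; rewrite !mem_filter !mem_permutations.
  move=> /andP[P1 p1] /andP[P2 p2] ->.
  rewrite (permPr (fv_rem qG)) perm_cat ?perm_map // andbT.
  rewrite /pres /fv /= -/(fv F) !size_cat !size_map.
  have e1 : size (vertices t) = size w1 by case/andP: P1 => /eqP.
  have e2 : size (fv F) = size w2 by case/andP: P2 => /eqP.
  rewrite e1 e2 eqxx zip_cat ?size_map //= allrel_catl !allrel_catr.
  have := P1; rewrite -(pres_map_cons i q.1) => /andP[_ ->].
  case/andP: P2 => _ ->; rewrite /= andbT.
  (* Addresses in different branches are incomparable both in the source and in the target, so mixed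
     pairs impose no condition. *)
  have key x y : x \in zip (map (cons i) (vertices t)) (map (cons q.1) w1) ->
      y \in zip (fv F) w2 -> exists i1 i2 j1 j2 b1 b2 c1 c2,
        [/\ x = (i1 :: b1, i2 :: b2), y = (j1 :: c1, j2 :: c2), i1 != j1 & i2 != j2].
    case: x y => [x1 x2] [y1 y2] /mem_zip[/mapP[a _ ->] /mapP[b _ ->]] /mem_zip[].
    rewrite (perm_mem p2) => /mem_fv[p pF [c _ ->]] /mem_fv[r rG [d _ ->]].
    exists i, q.1, p.1, r.1, a, b, c, d; split => //.
      by rewrite eq_sym; apply: iF; rewrite map_f.
    by rewrite eq_sym (rem_label uG qG).
  apply/andP; split; apply/allrelP => x y Hx Hy.
    have [i1 [i2 [j1 [j2 [b1 [b2 [c1 [c2 [-> -> n1 n2]]]]]]]]] := key _ _ Hx Hy.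
    by rewrite /= (negPf n1) (negPf n2).
  have [i1 [i2 [j1 [j2 [b1 [b2 [c1 [c2 [-> -> n1 n2]]]]]]]]] := key _ _ Hy Hx.
by rewrite /= (eq_sym j1) (negPf n1) (eq_sym j2) (negPf n2).
rewrite mem_filter mem_permutations => /andP[P pw].
set V1 := map (cons i) (vertices t).
have EF : fv ((i, t) :: F) = V1 ++ fv F by [].
rewrite EF in P.
pose n := size V1; have szw : size (V1 ++ fv F) = size ws by case/andP: P => /eqP.
have [u1 [u2 [ews su1]]] : exists u1 u2, ws = u1 ++ u2 /\ size V1 = size u1.
  exists (take n ws), (drop n ws); rewrite cat_take_drop size_takel //.
  by rewrite -szw size_cat leq_addr.
have su2 : size (fv F) = size u2.
  by move: szw; rewrite ews !size_cat su1 => /addnI.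
have zE : zip (V1 ++ fv F) ws = zip V1 u1 ++ zip (fv F) u2 by rewrite ews zip_cat.
(* [r] is the image of the root of the first branch, and [q] below is the tree of [G] into which it
   falls. *)
have [r rV] : exists r, ([:: i], r) \in zip V1 u1.
  by apply: mem_zip_l => //; apply: map_f; apply: root_in.
have rZ : ([:: i], r) \in zip (V1 ++ fv F) ws by rewrite zE mem_cat rV.
have : r \in fv G by have [_] := mem_zip rZ; rewrite (perm_mem pw).
case/mem_fv => q qG [b _ er].
have qw : [:: q.1] \in ws.
  by rewrite (perm_mem pw); apply/mem_fv; exists q => //; exists [::]; rewrite ?root_in.
(* The vertex [x] sent to the root of [q] is a nonempty prefix of [[:: i]], hence equal to it; so
   [r] is the root of [q]. *)
have [x xZ] := mem_zip_r szw qw.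
have xi : x = [:: i].
  have := pres_prefix P xZ rZ; rewrite er prefix1 eqxx.
  have [+ _] := mem_zip xZ; rewrite -EF => /mem_fv[p _ [c _ ->]].
  by rewrite prefix_cons prefixs0 => /andP[/eqP-> /eqP->].
have {b}er : r = [:: q.1].
  have := pres_prefix P rZ xZ; rewrite xi prefix1 eqxx er.
  by rewrite prefix_cons prefixs0 => /esym/andP[_ /eqP->].
have pre z y : (z, y) \in zip (V1 ++ fv F) ws -> prefix [:: q.1] y = prefix [:: i] z.
  by move=> yZ; rewrite (pres_prefix P rZ yZ) er.
have all1 : all (prefix [:: q.1]) u1.
  apply/allP => y yu; have [z zZ] := mem_zip_r su1 yu.
  rewrite (pre z y) ?zE ?mem_cat ?zZ //.
  by have [/mapP[c _ ->] _] := mem_zip zZ; rewrite prefix1.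
have all2 : all (predC (prefix [:: q.1])) u2.
  apply/allP => y yu; have [z zZ] := mem_zip_r su2 yu.
  rewrite /= -/(prefix [:: q.1] y) (pre z y) ?zE ?mem_cat ?zZ ?orbT //.
  have [/mem_fv[p pF [c _ ->]] _] := mem_zip zZ; rewrite prefix1 eq_sym.
  by apply: iF; rewrite map_f.
have [q1 q2] : perm_eq u1 (map (cons q.1) (vertices q.2)) /\ perm_eq u2 (fv (rem q G)).
  have a1 : all (prefix [:: q.1]) (map (cons q.1) (vertices q.2)).
    by apply/allP => y /mapP[c _ ->]; rewrite prefix1.
  have a2 : all (predC (prefix [:: q.1])) (fv (rem q G)).
    apply/allP => y /mem_fv[p pr [c _ ->]]; rewrite /= eq_sym.
    by rewrite (negPf (rem_label uG qG pr)).
  have := perm_trans pw (fv_rem qG); rewrite ews => H.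
  (* The prefix [[:: q.1]] tells the two halves apart, so filtering by it splits the permutation in
     two. *)
  have F1 (T : eqType) (a : pred T) s1 s2 : all a s1 -> all (predC a) s2 ->
      filter a (s1 ++ s2) = s1 /\ filter (predC a) (s1 ++ s2) = s2.
    rewrite !filter_cat => h1 h2; rewrite (all_filterP h1) (all_filterP h2).
    rewrite -(eq_filter (a1 := predC (predC a)) (a2 := a)); last by move=> z /=; rewrite negbK.
    split; last by rewrite (_ : filter _ s1 = [::]) //; apply/eqP; rewrite -[_ == _]negbK -has_filter has_predC h1.
    by rewrite (_ : filter _ s2 = [::]) ?cats0 //; apply/eqP; rewrite -[_ == _]negbK -has_filter has_predC h2.
  have [f1 f2] := F1 _ _ _ _ all1 all2; have [g1 g2] := F1 _ _ _ _ a1 a2.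
  by split; [rewrite -f1 -g1 | rewrite -f2 -g2]; apply: perm_filter.
have e1 : u1 = map (cons q.1) (map behead u1).
  rewrite -map_comp -[LHS]map_id; apply/eq_in_map => y yu /=.
  by move/allP/(_ y yu): all1; case: (y) => //= a c /andP[/eqP->].
move: P; rewrite /pres zE => /andP[_]; rewrite allrel_catl !allrel_catr.
case/andP=> /andP[P1 _] /andP[_ P2].
exists q, (map behead u1), u2; split => //; last by rewrite -e1 ews.
  rewrite mem_filter mem_permutations; apply/andP; split.
    by rewrite -(pres_map_cons i q.1) -e1 /pres su1 eqxx P1.
  by apply: (@perm_map_inj _ _ (cons q.1)) => [? ? []//|]; rewrite -e1.
by rewrite mem_filter mem_permutations q2 /pres su2 eqxx P2.
Qed.

Lemma size_fisos_cons i t F G : uniq (i :: map fst F) -> uniq (map fst G) ->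
  size (fisos ((i, t) :: F) G)
  = \sum_(q <- G) niso t q.2 * size (fisos F (rem q G)).
Proof.
move=> uF uG.
pose W q := [seq (w1, w2) | w1 <- isos t q.2, w2 <- fisos F (rem q G)].
pose f (q : nat * tree) (w : seq (seq nat) * seq (seq nat)) := map (cons q.1) w.1 ++ w.2.
rewrite (@perm_size _ _ [seq f q w | q <- G, w <- W q]).
  rewrite size_allpairs_dep sumnE big_map; apply: eq_bigr => q _.
  by rewrite size_allpairs.
have uI s : uniq (isos t s) by rewrite filter_uniq ?permutations_uniq.
have uFI F' G' : uniq (fisos F' G') by rewrite filter_uniq ?permutations_uniq.
have WP q w : w \in W q -> w.1 \in isos t q.2 /\ w.2 \in fisos F (rem q G).
  by case/allpairsP => p [p1 p2 ->].
apply: uniq_perm => //.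
  apply: allpairs_uniq_dep => [|q qG|].
  - exact: map_uniq uG.
  - by apply: allpairs_uniq => //; case=> ? ? [? ?] _ _ [-> ->].
  move=> x y /allpairsPdep[q1 [w1 [qG1 /WP[m1 m1'] ->]]].
  move=> /allpairsPdep[q2 [w2 [qG2 /WP[m2 m2'] ->]]]; rewrite /f /= => E.
  have cI (n : nat) : injective (cons n) by move=> ? ? [].
  have S (s : tree) w : w \in isos t s -> size w = size (vertices t).
    by rewrite mem_filter => /andP[/andP[/eqP-> _] _].
  move/eqP: E; rewrite eqseq_cat ?size_map ?(S _ _ m1) ?(S _ _ m2) // => /andP[/eqP E1 /eqP E2].
  (* The label of the chosen tree is the head of the first address, which exists because every tree
     has a root. *)
  have E3 : q1.1 = q2.1.
    case: (w1.1) (w2.1) (S _ _ m1) E1 => [|a s] [|b s'] //=; last by move=> _ [].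
    by move=> e; have := size_vertices t; rewrite -e.
  have {}E3 : q1 = q2.
    apply/eqP; apply: contraTT isT => ne12.
    suff /(rem_label uG qG1) : q2 \in rem q1 G by rewrite E3 eqxx.
    by rewrite mem_rem_uniq ?(map_uniq uG) // !inE eq_sym ne12.
  subst q2; congr existT; move/(inj_map (cI _)): E1.
  by case: (w1) (w2) E2 => ? ? [? ?] /= -> ->.
move=> ws; apply/fisos_consP/allpairsPdep => //.
  case=> q [w1 [w2 [qG h1 h2 ->]]]; exists q, (w1, w2); split => //.
  by apply/allpairsP; exists (w1, w2).
case=> q [w [qG /WP[h1 h2] ->]]; exists q, w.1, w.2; split => //.
Qed.

Lemma size_fisos F G : uniq (map fst F) -> uniq (map fst G) ->
  size (fisos F G) = permanent (fun p q => niso p.2 q.2) F G.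
Proof.
elim: F G => [|[i t] F IH] G uF uG; last first.
  rewrite size_fisos_cons //= picks_uniq ?(map_uniq uG) // big_map.
  apply: eq_big_seq => q qG /=; rewrite IH //.
    by case/andP: uF.
  exact: subseq_uniq (map_subseq _ (rem_subseq q G)) uG.
rewrite /fisos /=; case: G {uG} => [|[j t] G] //=.
rewrite size_filter; apply/eqP; rewrite -leqn0 leqNgt -has_count; apply/hasPn => ws.
rewrite mem_permutations => /perm_size /= e; rewrite /pres /=.
by case: eqP => // e'; move: e; rewrite -e' /fv /= size_cat size_map; case: (t).
Qed.

(** Roots correspond, so an isomorphism is a matching of the branches together with an isomorphism
    for each matched pair. The labels are then forgotten. *)
Lemma nisoE ts ss : niso (Node ts) (Node ss) = permanent niso ts ss.
Proof.
rewrite niso_fisos size_fisos ?label_labels ?iota_uniq //.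
by rewrite -(permanent_map niso snd snd) !label_trees.
Qed.

Lemma niso_sym t s : niso t s = niso s t.
Proof.
elim/tree_ind_mem: t s => ts IH [ss]; rewrite !nisoE [RHS]permanent_sym.
elim: ts ss IH => //= t ts IHts ss IH; apply: eq_bigr => p _.
by rewrite IH ?mem_head // IHts // => r rts; apply: IH; rewrite inE rts orbT.
Qed.

Lemma iso_refl t : iso t t.
Proof.
elim/tree_ind_mem: t => ts IH; rewrite -niso_gt0 nisoE.
elim: ts IH => //= t ts IHts IH; rewrite big_cons ltn_addr // muln_gt0 /=.
rewrite niso_gt0 IH ?mem_head //= IHts // => r rts.
by apply: IH; rewrite inE rts orbT.
Qed.

(** A nonzero term of the permanent matches the first branch with an isomorphic one; moving the
    latter to the front allows the two row expansions to be compared term by term. *)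
Lemma niso_congr t s : iso t s -> niso t =1 niso s.
Proof.
elim/tree_ind_mem: t s => ts IH [ss]; rewrite -niso_gt0 nisoE => H [us].
rewrite !nisoE; elim: ts ss us IH H => [|t ts IHts] ss us IH /=; first by case: ss.
case: (boolP (has (fun p => 0 < niso t p.1 * permanent niso ts p.2) (picks ss))); last first.
  move/hasPn => H; rewrite big_seq big1 // => p /H.
  by rewrite -leqNgt leqn0 => /eqP.
case/hasP=> p pss; rewrite muln_gt0 niso_gt0 => /andP[tp H] _.
rewrite [RHS](permanent_perm_rows _ _ (picks_perm pss)) /=; apply: eq_bigr => q _.
rewrite (IH t (mem_head _ _) _ tp) (IHts p.2) // => r rts.
by apply: IH; rewrite inE rts orbT.
Qed.

Lemma iso_sym t s : iso t s = iso s t.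
Proof. by rewrite -!niso_gt0 niso_sym. Qed.

Lemma iso_trans t s r : iso t s -> iso t r = iso s r.
Proof. by move=> /niso_congr H; rewrite -!niso_gt0 H. Qed.

(** Thus [niso] is the inner product of rooted trees, in a form that obeys the recursion [nisoE]. *)
Lemma nisoE_aut t s : niso t s = iso t s * aut s.
Proof.
case: (boolP (iso t s)) => [/niso_congr-> | ]; first by rewrite mul1n niso_aut.
by rewrite -niso_gt0 -leqNgt leqn0 => /eqP->.
Qed.

Lemma aut_gt0 t : 0 < aut t.
Proof. by rewrite niso_aut niso_gt0 iso_refl. Qed.

Lemma iso_aut t s : iso t s -> aut t = aut s.
Proof.
by move=> ts; rewrite !niso_aut (niso_congr ts) niso_sym (niso_congr ts).
Qed.

(** * Admissible cuts and the Grossman-Larson product *)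

(* Admissible cuts, as pairs (pruned forest, trunk); [tcuts t] includes the cut
   removing [t] entirely. *)
Fixpoint tcuts (t : tree) : seq (seq tree * seq tree) :=
  let: Node us := t in
  ([:: t], [::]) :: [seq (p.1, [:: Node p.2]) | p <-
    (fix go (us : seq tree) := 
       if us is s :: us' then [seq (p.1 ++ q.1, p.2 ++ q.2) | p <- tcuts s, q <- go us']
       else [:: ([::], [::])]) us].

Definition cuts (us : seq tree) : seq (seq tree * seq tree) :=
  foldr (fun s acc => [seq (p.1 ++ q.1, p.2 ++ q.2) | p <- tcuts s, q <- acc])
    [:: ([::], [::])] us.

Arguments cuts : simpl never.

Lemma cuts_cons us vs : cuts (Node us :: vs) =
  [seq (Node us :: q.1, q.2) | q <- cuts vs] ++
  [seq (p.1 ++ q.1, Node p.2 :: q.2) | p <- cuts us, q <- cuts vs].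
Proof.
rewrite {1}/cuts /= -/(cuts vs); congr (_ ++ _).
rewrite /allpairs_dep -map_comp; congr (flatten (map _ _)).
Qed.

(** The recursion that [cuts_cons] follows: the children of the first root, and the remaining
    trees. *)
Lemma forest_ind (P : seq tree -> Prop) :
  P [::] -> (forall us vs, P us -> P vs -> P (Node us :: vs)) -> forall us, P us.
Proof.
move=> P0 Pc.
suff H t : P (children t) by move=> us; exact: (H (Node us)).
elim/tree_ind_mem: t => /= ts; elim: ts => // -[us] vs IH H; apply: Pc.
  exact: (H (Node us) (mem_head _ _)).
by apply: IH => t tvs; apply: H; rewrite inE tvs orbT.
Qed.

Lemma filter_cuts_r us : [seq c <- cuts us | nilp c.2] = [:: (us, [::])].
Proof.
elim/forest_ind: us => // us vs _ IH; rewrite cuts_cons filter_cat filter_map /=.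
rewrite (eq_filter (a2 := fun c => nilp c.2)) // IH /=; congr cons.
by apply/eqP; rewrite -[_ == _]negbK -has_filter; apply/hasPn => c /allpairsP[p [_ _ ->]].
Qed.

Lemma filter_cuts_l us : [seq c <- cuts us | nilp c.1] = [:: ([::], us)].
Proof.
elim/forest_ind: us => // us vs IHu IHv; rewrite cuts_cons filter_cat filter_map /=.
rewrite (eq_filter (a2 := pred0)) // filter_pred0 /=.
pose f (p q : seq tree * seq tree) := (p.1 ++ q.1, Node p.2 :: q.2).
have H (s r : seq (seq tree * seq tree)) : [seq c <- [seq f p q | p <- s, q <- r] | nilp c.1] =
    [seq f p q | p <- [seq c <- s | nilp c.1], q <- [seq c <- r | nilp c.1]].
  elim: s => //= p s IHs; rewrite filter_cat IHs; case: ifP => /= np.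
    congr cat; rewrite filter_map; congr map; apply: eq_filter => q /=.
    by rewrite /nilp size_cat addn_eq0 -!/(nilp _) np.
  rewrite -[RHS]cat0s; congr cat; apply/eqP; rewrite -[_ == _]negbK -has_filter.
  apply/hasPn => c /mapP[q _ ->] /=; rewrite /nilp size_cat addn_eq0 -!/(nilp _).
  by rewrite np.
by rewrite -/(allpairs f _ _) H IHu IHv.
Qed.

(** Every tree of a trunk comes from a tree of [us] whose root is kept, so it may be chosen before
    cutting. This reorders the pruned part, whence the invariance required of [Phi]. *)
Lemma big_cuts_picks (Phi : seq tree -> tree -> seq tree -> nat) us :
  (forall P Q t R, perm_eq P Q -> Phi P t R = Phi Q t R) ->
  \sum_(c <- cuts us) \sum_(x <- picks c.2) Phi c.1 x.1 x.2
  = \sum_(x <- picks us) \sum_(c <- cuts (children x.1)) \sum_(d <- cuts x.2)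
      Phi (c.1 ++ d.1) (Node c.2) d.2.
Proof.
elim: us Phi => [|[us] vs IH] Phi permP; first by rewrite !big_nil big_seq1 big_nil.
rewrite cuts_cons big_cat big_map big_allpairs_dep /= big_cons big_map /= addnC.
under eq_bigr do under eq_bigr do rewrite big_cons.
under eq_bigr do rewrite big_split.
rewrite big_split -addnA; congr (_ + _).
rewrite addnC.
under [in RHS]eq_bigr do under eq_bigr do rewrite cuts_cons big_cat big_map big_allpairs_dep.
under [in RHS]eq_bigr do rewrite big_split.
rewrite big_split; congr (_ + _).
  rewrite (IH (fun P t R => Phi (Node us :: P) t R)); last first.
    by move=> P Q t R PQ; apply: permP; rewrite perm_cons.
  apply: eq_bigr => x _; apply: eq_bigr => c _; apply: eq_bigr => d _ /=.
  by apply: permP; rewrite (perm_catCA [:: Node us] c.1 d.1).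
under eq_bigr => c _.
  under eq_bigr do rewrite big_map /=.
  rewrite (IH (fun P t R => Phi (c.1 ++ P) t (Node c.2 :: R))); last first.
    by move=> P Q t R PQ; apply: permP; rewrite perm_cat2l.
  over.
rewrite exchange_big; apply: eq_bigr => x _.
rewrite exchange_big; apply: eq_bigr => c _ /=.
apply: eq_bigr => d _; apply: eq_bigr => e _.
by apply: permP; rewrite perm_catCA.
Qed.

Lemma permanent_nil_cuts T (K : T -> tree -> nat) cs us :
  permanent K cs us = \sum_(c <- cuts us) permanent K cs c.1 * nilp c.2.
Proof.
rewrite (eq_bigr (fun c => if nilp c.2 then permanent K cs c.1 else 0)); last first.
  by move=> c _; case: ifP; rewrite ?muln1 ?muln0.
by rewrite -big_mkcond -big_filter filter_cuts_r big_seq1.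
Qed.

(** * Attaching a family of trees at prescribed vertices *)

Definition assigns (V : seq (seq nat)) (cs : seq tree) : seq (seq (seq nat * tree)) :=
  [seq zip v cs | v <- choices (size cs) V].

Lemma assigns_cons V c cs :
  assigns V (c :: cs) = [seq (v, c) :: z | v <- V, z <- assigns V cs].
Proof.
rewrite /assigns /= map_flatten -map_comp; congr flatten.
by apply: eq_map => v /=; rewrite -!map_comp.
Qed.

(** First decide which trees go to addresses satisfying [p], then place the two groups
    independently; each group keeps its order. *)
Lemma big_assigns_split (p : pred (seq nat)) V cs (Phi : seq (seq nat * tree) -> seq (seq nat * tree) -> nat) :
  \sum_(z <- assigns V cs) Phi (filter (fun x => p x.1) z) (filter (fun x => ~~ p x.1) z)
  = \sum_(d <- splits cs) \sum_(z1 <- assigns (filter p V) d.1)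
      \sum_(z2 <- assigns (filter (predC p) V) d.2) Phi z1 z2.
Proof.
elim: cs Phi => [|c cs IH] Phi; first by rewrite !big_seq1.
rewrite assigns_cons big_allpairs_dep (bigID p) /= big_cat !big_map /=; congr (_ + _).
  under [RHS]eq_bigr do rewrite assigns_cons big_allpairs_dep.
  rewrite [RHS]exchange_big /= big_filter; apply: eq_bigr => v pv.
  by under eq_bigr do rewrite pv /=; rewrite -(IH (fun a b => Phi ((v, c) :: a) b)).
under [RHS]eq_bigr do under eq_bigr do rewrite assigns_cons big_allpairs_dep.
under [RHS]eq_bigr do rewrite exchange_big.
rewrite [RHS]exchange_big /= big_filter; apply: eq_bigr => v pv.
by under eq_bigr do rewrite pv (negPf pv) /=; rewrite -(IH (fun a b => Phi a ((v, c) :: b))).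
Qed.

Lemma mem_assigns V cs z x : z \in assigns V cs -> x \in z -> x.1 \in V.
Proof.
elim: cs z => [|c cs IH] z; first by rewrite inE => /eqP->.
rewrite assigns_cons => /allpairsP[[v z'] [/= vV zV ->]].
by rewrite inE => /predU1P[-> //|]; apply: IH.
Qed.

(* All addresses in [z] refer to the original tree: [graft] appends the new
   branch last, so they stay valid throughout the fold. *)
Definition attach (t : tree) (z : seq (seq nat * tree)) : tree :=
  foldl (fun s x => graft x.1 s x.2) t z.

Definition in_branch (i : nat) (a : seq nat) : bool := if a is j :: _ then j == i else false.

Definition branch_part (i : nat) (z : seq (seq nat * tree)) :=
  [seq (behead x.1, x.2) | x <- z & in_branch i x.1].

(** The branches after attachment: the old ones, each with its own share of [z], then the trees
    attached to the root itself. *)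
Definition attachF (i : nat) (ts : seq tree) (z : seq (seq nat * tree)) : seq tree :=
  [seq attach p.2 (branch_part p.1 z) | p <- label i ts] ++ [seq x.2 | x <- z & nilp x.1].

Lemma label_zip i ts : zip (iota i (size ts)) ts = label i ts.
Proof. by elim: ts i => //= t ts IH i; rewrite IH. Qed.

Lemma label_cat i ts us : label i (ts ++ us) = label i ts ++ label (i + size ts) us.
Proof. by elim: ts i => [|t ts IH] i /=; rewrite ?addn0 // IH addnS. Qed.

Lemma label_ge i ts p : p \in label i ts -> i <= p.1 < i + size ts.
Proof. by rewrite -mem_iota -(label_labels i ts) => /(map_f fst). Qed.

Lemma label_map_label i (f : nat * tree -> tree) ts :
  label i (map f (label i ts)) = [seq (p.1, f p) | p <- label i ts].
Proof. by elim: ts i => //= t ts IH i; rewrite IH. Qed.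

(** The induction is generalized over [us], the trees already attached to the root. *)
Lemma attach_Node_gen ts us z :
  (forall x, x \in z -> (head 0 x.1 < size ts) || nilp x.1) ->
  attach (Node (ts ++ us)) z =
  Node ([seq attach p.2 (branch_part p.1 z) | p <- label 0 ts] ++ us ++ [seq x.2 | x <- z & nilp x.1]).
Proof.
elim: z ts us => [|[a c] z IH] ts us H /=.
  by rewrite cats0 /attach /= /branch_part /= label_trees.
have Hz x : x \in z -> (head 0 x.1 < size ts) || nilp x.1.
  by move=> xz; apply: H; rewrite inE xz orbT.
rewrite /attach /= -/(attach _ z).
case: a H => [|i a] H /=.
  rewrite rcons_cat IH // cat_rcons.
  by congr (Node (_ ++ _)); apply: eq_map => p; rewrite /branch_part.
have := H _ (mem_head _ _); rewrite /= orbF => ilt.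
rewrite label_zip label_cat map_cat add0n.
(* The trees of [us] have indices from [size ts] on, so no address of [z] points into them. *)
have -> : [seq (if p.1 == i then graft a p.2 c else p.2) | p <- label (size ts) us] = us.
  rewrite -[RHS](label_trees (size ts)); apply/eq_in_map => p /label_ge /andP[lt _].
  by case: eqP => // e; move: lt; rewrite e leqNgt ilt.
rewrite IH; last first.
  by move=> x /Hz; rewrite size_map -(size_map fst) label_labels size_iota.
rewrite label_map_label -map_comp; congr (Node (_ ++ _)).
apply: eq_map => p /=; rewrite /branch_part /= eq_sym.
by case: eqP => //= ->; rewrite ?eqxx.
Qed.

Lemma attach_Node ts z :
  (forall x, x \in z -> (head 0 x.1 < size ts) || nilp x.1) ->
  attach (Node ts) z = Node (attachF 0 ts z).
Proof. by move=> H; rewrite -{1}[ts]cats0 attach_Node_gen. Qed.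

Lemma attachF_cons i t ts z :
  attachF i (t :: ts) z =
  attach t (branch_part i (filter (fun x => in_branch i x.1) z))
  :: attachF i.+1 ts (filter (fun x => ~~ in_branch i x.1) z).
Proof.
rewrite /attachF /=; congr (attach _ _ :: _ ++ _).
- by rewrite /branch_part -filter_predI; congr map; apply: eq_filter => x /=; rewrite andbb.
- apply/eq_in_map => p /label_ge/andP[ip _]; congr attach.
  rewrite /branch_part -filter_predI; congr map; apply: eq_filter => -[[|j a] c] //=.
  by case: (j =P p.1) => //= ->; rewrite eq_sym ltn_eqF.
by rewrite -filter_predI; congr map; apply: eq_filter => -[[|j a] c].
Qed.

Lemma big_assigns_branch i V cs (F : seq (seq nat * tree) -> nat) :
  \sum_(z <- assigns (map (cons i) V) cs) F (branch_part i z) = \sum_(z <- assigns V cs) F z.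
Proof.
elim: cs F => [|c cs IH] F; first by rewrite !big_seq1.
rewrite !assigns_cons !big_allpairs_dep big_map; apply: eq_bigr => v _.
rewrite -IH; apply: eq_bigr => z _.
by rewrite /branch_part /= eqxx.
Qed.

Lemma big_assigns_root cs (F : seq tree -> nat) :
  \sum_(z <- assigns [:: [::]] cs) F [seq x.2 | x <- z & nilp x.1] = F cs.
Proof.
elim: cs F => [|c cs IH] F; first by rewrite !big_seq1.
rewrite assigns_cons big_allpairs_dep big_seq1 /=.
by rewrite -[RHS](IH (fun s => F (c :: s))).
Qed.

(* Mirrors the recursion of cuts: the trees [cs] are dealt out to the first
   branch and the rest, and the first branch is matched with some tree of [us]. *)
Lemma sum_attachF i ts cs us :
  (forall t, t \in ts -> forall cs us,
    \sum_(z <- assigns (vertices t) cs) niso (attach t z) (Node us)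
    = \sum_(c <- cuts us) permanent niso cs c.1 * niso t (Node c.2)) ->
  \sum_(z <- assigns ([::] :: fv (label i ts)) cs) permanent niso (attachF i ts z) us
  = \sum_(c <- cuts us) permanent niso cs c.1 * permanent niso ts c.2.
Proof.
elim: ts i cs us => [|t ts IH] i cs us H.
  by rewrite (big_assigns_root cs (fun s => permanent niso s us)) permanent_nil_cuts.
under eq_bigr do rewrite attachF_cons.
rewrite (big_assigns_split (in_branch i) _ _ (fun z1 z2 =>
  permanent niso (attach t (branch_part i z1) :: attachF i.+1 ts z2) us)).
(* The root address stays with the later branches, so that their sum has the shape of the induction
   hypothesis. *)
have [-> ->] : filter (in_branch i) ([::] :: fv (label i (t :: ts))) = map (cons i) (vertices t)
    /\ filter (predC (in_branch i)) ([::] :: fv (label i (t :: ts))) = [::] :: fv (label i.+1 ts).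
  rewrite /fv /= -/(fv _) !filter_cat.
  have h1 : all (in_branch i) (map (cons i) (vertices t)) by apply/allP => y /mapP[a _ ->] /=.
  have h2 : all (predC (in_branch i)) (fv (label i.+1 ts)).
    apply/allP => y /mem_fv[p /label_ge/andP[ip _] [a _ ->]] /=.
    by rewrite eq_sym ltn_eqF.
  rewrite (all_filterP h1) (all_filterP h2).
  split; last congr cons.
    rewrite -[RHS]cats0; congr cat; apply/eqP; rewrite -[_ == _]negbK -has_filter.
    by rewrite -all_predC.
  rewrite -[RHS]cat0s; congr cat; apply/eqP; rewrite -[_ == _]negbK -has_filter.
  by rewrite has_predC h1.
transitivity (\sum_(d <- splits cs) \sum_(x <- picks us)
   (\sum_(c <- cuts (children x.1)) permanent niso d.1 c.1 * niso t (Node c.2)) *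
   (\sum_(c <- cuts x.2) permanent niso d.2 c.1 * permanent niso ts c.2)).
  apply: eq_bigr => d _ /=.
  under eq_bigr do rewrite exchange_big.
  rewrite exchange_big; apply: eq_bigr => -[[vs] ws] _ /=.
  under eq_bigr do rewrite -big_distrr.
  rewrite -big_distrl; congr (_ * _).
    rewrite (big_assigns_branch _ _ _ (fun z => niso (attach t z) (Node vs))).
    by rewrite H ?mem_head.
  by apply: IH => s sts; apply: H; rewrite inE sts orbT.
rewrite exchange_big /=.
(* On the other side the row of [t] picks a tree of the trunk; [big_cuts_picks] moves this choice
   before the cut. *)
transitivity (\sum_(c <- cuts us) \sum_(x <- picks c.2)
    permanent niso cs c.1 * (niso t x.1 * permanent niso ts x.2)); last first.
  by apply: eq_bigr => c _; rewrite big_distrr.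
rewrite (@big_cuts_picks (fun P s R => permanent niso cs P * (niso t s * permanent niso ts R))); last first.
  by move=> P Q s R PQ; rewrite (permanent_perm_cols _ _ PQ).
apply: eq_bigr => x _.
under eq_bigr do rewrite big_distrl.
rewrite exchange_big; apply: eq_bigr => c _ /=.
under eq_bigr do rewrite big_distrr.
rewrite exchange_big; apply: eq_bigr => d _ /=.
rewrite permanent_cat big_distrl; apply: eq_bigr => e _ /=.
by rewrite mulnACA.
Qed.

Lemma sum_attach t cs us :
  \sum_(z <- assigns (vertices t) cs) niso (attach t z) (Node us)
  = \sum_(c <- cuts us) permanent niso cs c.1 * niso t (Node c.2).
Proof.
elim/tree_ind_mem: t cs us => ts IH cs us.
under [RHS]eq_bigr do rewrite nisoE.
rewrite -(sum_attachF 0) // -vertices_Node; apply: eq_big_seq => z zV.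
rewrite attach_Node ?nisoE // => -[a c] /(mem_assigns zV).
rewrite vertices_Node inE /= => /predU1P[-> |/mem_fv[p /label_ge/= + [b _ ->]]] /=.
  by rewrite orbT.
by rewrite orbF.
Qed.

Lemma sum_gl_tt t t' us :
  \sum_(s <- gl_tt t t') niso s (Node us)
  = \sum_(c <- cuts us) niso t (Node c.1) * niso t' (Node c.2).
Proof.
case: t => ts; under [RHS]eq_bigr do rewrite nisoE.
by rewrite -sum_attach /gl_tt /assigns !big_map.
Qed.

(** * The pairing of NSym with forests *)

Definition fsize (us : seq tree) : nat := sumn (map Defs.tsize us).

Lemma tsize_Node us : Defs.tsize (Node us) = (fsize us).+1.
Proof.
rewrite /Defs.tsize vertices_Node /= /fv size_flatten /shape -map_comp; congr (sumn _).+1.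
by rewrite -[in RHS](label_trees 0 us) -[RHS]map_comp; apply: eq_map => p /=; rewrite size_map.
Qed.

Lemma fsize_cat us vs : fsize (us ++ vs) = fsize us + fsize vs.
Proof. by rewrite /fsize map_cat sumn_cat. Qed.

Lemma fsize_cons us vs : fsize (Node us :: vs) = (fsize us + fsize vs).+1.
Proof. by rewrite /fsize /= tsize_Node. Qed.

Lemma fsize_bullets n : fsize (nseq n bullet) = n.
Proof. by elim: n => // n IH; rewrite /= fsize_cons IH. Qed.

Lemma fsize_cuts us c : c \in cuts us -> fsize c.1 + fsize c.2 = fsize us.
Proof.
elim/forest_ind: us c => [|us vs IHu IHv] c; first by rewrite inE => /eqP->.
rewrite cuts_cons mem_cat fsize_cons => /orP[/mapP[q qv ->]|/allpairsP[[p q] [/= pu qv ->]]].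
  by rewrite /= fsize_cons -(IHv _ qv) addSn addnA.
rewrite /= fsize_cat fsize_cons -(IHu _ pu) -(IHv _ qv) addnS.
by rewrite addnACA.
Qed.

Lemma forestsS f M : forests f.+1 M.+1 =
  flatten [seq flatten [seq [seq Node c :: r | r <- forests f (M.+1 - j)]
                       | c <- forests f j.-1] | j <- iota 1 M.+1].
Proof. by []. Qed.

(** Both recursive calls concern forests with fewer vertices, so fuel above the number of vertices
    suffices. *)
Lemma mem_forests fuel us : fsize us < fuel -> us \in forests fuel (fsize us).
Proof.
elim: fuel us => // f IH [|[c] r] lt; first by rewrite /= mem_head.
rewrite fsize_cons in lt *; move: lt; rewrite ltnS forestsS => lt.
apply/flatten_mapP; exists (fsize c).+1; first by rewrite mem_iota /= add1n !ltnS leq_addr.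
apply/flatten_mapP; exists c => /=.
  by apply: IH; apply: leq_trans lt; rewrite ltnS leq_addr.
apply: map_f; rewrite subSS addKn; apply: IH.
by apply: leq_trans lt; rewrite ltnS leq_addl.
Qed.

Lemma forests_size fuel M us : us \in forests fuel M -> fsize us = M.
Proof.
elim: fuel M us => // f IH M us /=; case: eqP => [->|_].
  by rewrite inE => /eqP->.
case/flatten_mapP => j; rewrite mem_iota => /andP[j0 jM].
case/flatten_mapP => c /IH ec /mapP[r /IH er ->].
by rewrite fsize_cons ec er -addSn prednK // subnKC // -ltnS.
Qed.

Lemma has_trees_of_size s n : has (iso^~ s) (trees_of_size n.+1) = (Defs.tsize s == n.+1).
Proof.
apply/hasP/eqP => [[t]|es].
  by case/mapP => us /forests_size e ->; rewrite /iso tsize_Node e => /andP[/eqP].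
exists s; last exact: iso_refl.
case: s es => us; rewrite tsize_Node => -[<-]; apply: map_f; exact: mem_forests.
Qed.

(** An isomorphism class met in [acc] receives no further member. For empty [acc], each class
    occurring in [l] is kept exactly once. *)
Lemma count_dedup_iso s acc l :
  count (iso^~ s) (dedup_iso acc l) =
  if has (iso^~ s) acc then count (iso^~ s) acc else has (iso^~ s) l.
Proof.
elim: l acc => [|t l IH] acc /=.
  by rewrite count_rev has_count; case: (count _ _).
case: ifP => [/hasP[t' t'acc tt']|nacc].
  rewrite IH; case: ifP => // nas.
  have -> // : iso t s = false.
  by apply/negbTE/negP; rewrite (iso_trans _ tt') => ts; move/hasP: nas; case; exists t'.
rewrite IH /=; case: (boolP (iso t s)) => //= ts.
have nas : has (iso^~ s) acc = false.
  apply/negbTE/hasPn => t' t'acc; apply/negP => t's; move/hasP: nacc; case; exists t' => //.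
  by rewrite (iso_trans _ ts) iso_sym.
by rewrite nas; move: nas; rewrite has_count; case: (count _ acc).
Qed.

Import GRing.Theory.
Local Open Scope ring_scope.

(** * The Grossman-Larson product is dual to cutting *)

Section Pairing.
Variable k : fieldType.
Implicit Types (x y : kT k).

Lemma big_cuts_cat us vs (F : seq tree -> seq tree -> k) :
  \sum_(c <- cuts (us ++ vs)) F c.1 c.2
  = \sum_(c <- cuts us) \sum_(d <- cuts vs) F (c.1 ++ d.1) (c.2 ++ d.2).
Proof.
elim: us F => [|[us] ws IH] F; first by rewrite big_seq1.
rewrite cat_cons !cuts_cons !big_cat !big_map !big_allpairs_dep /=; congr (_ + _).
  by rewrite (IH (fun a b => F (Node us :: a) b)).
apply: eq_bigr => c _; rewrite (IH (fun a b => F (c.1 ++ a) (Node c.2 :: b))).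
by apply: eq_bigr => d _; apply: eq_bigr => e _; rewrite catA.
Qed.

Lemma pairT_sum x us : pairT x us = \sum_(p <- x) p.1 * (niso p.2 (Node us))%:R.
Proof.
rewrite /pairT /coefT big_distrl big_mkcond; apply: eq_bigr => p _ /=.
by rewrite nisoE_aut; case: ifP; rewrite ?mul1n // mul0n mulr0.
Qed.

Lemma pairT_scale a x us : pairT (scaleT a x) us = a * pairT x us.
Proof.
by rewrite !pairT_sum /scaleT big_map big_distrr; apply: eq_bigr => p _; rewrite /= mulrA.
Qed.

Lemma pairT_flatten (xs : seq (kT k)) us : pairT (flatten xs) us = \sum_(x <- xs) pairT x us.
Proof. by rewrite pairT_sum big_flatten; apply: eq_bigr => x _; rewrite pairT_sum. Qed.

Lemma pairT_glmul x y us :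
  pairT (glmul x y) us = \sum_(c <- cuts us) pairT x c.1 * pairT y c.2.
Proof.
rewrite /glmul pairT_flatten big_map.
under eq_bigr do rewrite pairT_flatten big_map.
transitivity (\sum_(p <- x) \sum_(q <- y) \sum_(c <- cuts us)
    (p.1 * (niso p.2 (Node c.1))%:R) * (q.1 * (niso q.2 (Node c.2))%:R)).
  apply: eq_bigr => p _; apply: eq_bigr => q _.
  rewrite pairT_sum big_map -big_distrr -natr_sum sum_gl_tt natr_sum big_distrr /=.
  by apply: eq_bigr => c _; rewrite natrM mulrACA.
under eq_bigr do rewrite exchange_big.
rewrite exchange_big; apply: eq_bigr => c _ /=; rewrite !pairT_sum big_distrl.
by apply: eq_bigr => p _; rewrite big_distrr.
Qed.
End Pairing.

(** * Pairings with [kappa] and [eps] in characteristic zero *)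

Section CharZero.
Variables (k : fieldType) (hk : [pchar k] =i pred0).

Lemma natr_aut_neq0 t : (aut t)%:R != 0 :> k.
Proof. by rewrite ((pcharf0P k).1 hk) -lt0n aut_gt0. Qed.

(** The coefficient cancels the order of the automorphism group, and exactly one listed tree is
    isomorphic to [Node us] when the sizes agree. *)
Lemma pairT_kappa n us : pairT (kappa k n) us = (fsize us == n)%:R.
Proof.
rewrite pairT_sum big_map /=.
transitivity (\sum_(t <- dedup_iso [::] (trees_of_size n.+1)) ((iso t (Node us))%:R : k)).
  apply: eq_bigr => t _; rewrite nisoE_aut; case: (boolP (iso _ _)) => [/iso_aut<-|_].
    by rewrite mul1n mulVf // natr_aut_neq0.
  by rewrite mul0n mulr0.
rewrite -natr_sum (_ : (\sum_(t <- _) _)%N = count (iso^~ (Node us)) (dedup_iso [::] (trees_of_size n.+1))).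
  by rewrite count_dedup_iso has_trees_of_size tsize_Node eqSS.
by rewrite -sumn_count sumnE big_map.
Qed.

Lemma size_epsl n : size (epsl k n) = n.+1.
Proof. by elim: n => //= n IH; rewrite size_rcons IH. Qed.

Lemma nth_epsl m n : (m <= n)%N -> nth [::] (epsl k n) m = eps k m.
Proof.
elim: n => [|n IH]; first by rewrite leqn0 => /eqP->.
rewrite leq_eqVlt => /predU1P[-> //|]; rewrite ltnS => mn.
by rewrite /= nth_rcons size_epsl ltnS mn IH.
Qed.

Lemma epslS n : epsl k n.+1 = rcons (epsl k n)
  (flatten [seq scaleT ((-1) ^+ i.-1) (glmul (kappa k i) (nth [::] (epsl k n) (n.+1 - i)))
           | i <- iota 1 n.+1]).
Proof. by []. Qed.

Lemma epsS n : eps k n.+1 =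
  flatten [seq scaleT ((-1) ^+ i.-1) (glmul (kappa k i) (eps k (n.+1 - i))) | i <- iota 1 n.+1].
Proof.
rewrite {1}/eps epslS nth_rcons size_epsl ltnn eqxx.
congr flatten; apply/eq_in_map => i; rewrite mem_iota => /andP[i1 _].
by rewrite nth_epsl // leq_subLR -[X in (X <= _)%N]add1n leq_add2r.
Qed.

(** Forests without edges; not fixing the number of vertices frees the sign argument from [n]. *)
Definition bullets (us : seq tree) : bool := us == nseq (fsize us) bullet.

Lemma bullets_cons us vs : bullets (Node us :: vs) = nilp us && bullets vs.
Proof.
rewrite /bullets fsize_cons /= eqseq_cons; case: us => [|t us]; first by rewrite eqxx.
by case: eqP.
Qed.

Lemma bullets_nseq us n : (us == nseq n bullet) = bullets us && (fsize us == n).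
Proof.
apply/eqP/andP => [->|[/eqP + /eqP <-]] //.
by rewrite /bullets fsize_bullets !eqxx.
Qed.

(* A root is either cut off, together with everything below it, or kept, in
   which case all of its children are cut off: the two signs are opposite. *)
Lemma alternating_cuts us :
  \sum_(c <- cuts us) (-1) ^+ fsize c.1 * (bullets c.2)%:R = (nilp us)%:R :> k.
Proof.
elim/forest_ind: us => [|us vs _ _]; first by rewrite big_seq1 mul1r.
rewrite cuts_cons big_cat big_map big_allpairs_dep /=.
have -> : \sum_(i <- cuts us) \sum_(j <- cuts vs)
    ((-1) ^+ fsize (i.1 ++ j.1) * (bullets (Node i.2 :: j.2))%:R : k)
  = \sum_(i <- cuts us | nilp i.2) \sum_(j <- cuts vs)
    (-1) ^+ fsize (i.1 ++ j.1) * (bullets j.2)%:R.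
  rewrite [RHS]big_mkcond; apply: eq_bigr => c _; case: ifP => nc.
    by apply: eq_bigr => d _; rewrite bullets_cons nc.
  by rewrite big1 // => d _; rewrite bullets_cons nc mulr0.
rewrite -[X in _ + X]big_filter filter_cuts_r big_seq1 -big_split big1 //= => d _.
by rewrite fsize_cons fsize_cat exprS mulN1r mulNr addNr.
Qed.

Lemma pairT_one us : pairT [:: (1, bullet)] us = (nilp us)%:R :> k.
Proof. by rewrite pairT_sum big_seq1 mul1r nisoE. Qed.

Lemma pairT_eps n us : pairT (eps k n) us = (us == nseq n bullet)%:R.
Proof.
elim/ltn_ind: n us => -[_ us|n IH us]; first by rewrite pairT_one; case: us.
rewrite epsS pairT_flatten big_map.
transitivity (\sum_(c <- cuts us) \sum_(i <- iota 1 n.+1) (-1) ^+ i.-1 *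
    ((fsize c.1 == i)%:R * (c.2 == nseq (n.+1 - i) bullet)%:R) : k).
  rewrite exchange_big; apply: eq_big_seq => i; rewrite mem_iota => /andP[i1 i2].
  rewrite pairT_scale pairT_glmul big_distrr; apply: eq_bigr => c _ /=.
  by rewrite pairT_kappa IH // ltn_subrL i1.
(* Cuts preserve the number of vertices, so both sides vanish unless [us] has [n.+1] of them. *)
case: (eqVneq (fsize us) n.+1) => [en|nn]; last first.
  rewrite bullets_nseq (negPf nn) andbF big_seq big1 // => c /fsize_cuts ec.
  rewrite big_seq big1 // => i; rewrite mem_iota => /andP[i1 i2].
  rewrite bullets_nseq -natrM mulnb; case: eqP => [ei|]; last by rewrite mulr0.
  rewrite [in X in bullets _ && X]eq_sym; case: eqP => [ej|]; last by rewrite andbF mulr0.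
  by case/eqP: nn; rewrite -ec ei -ej subnKC // -ltnS.
(* Only [i = fsize c.1] contributes. As [i] starts at 1, the cut that prunes nothing has no term;
   the first summand cancels its share of the full alternating sum. *)
transitivity (\sum_(c <- cuts us) ((nilp c.1)%:R * (bullets c.2)%:R
    - (-1) ^+ fsize c.1 * (bullets c.2)%:R) : k).
  apply: eq_big_seq => c /fsize_cuts ec.
  have e2 i : (fsize c.1 == i)%:R * (c.2 == nseq (n.+1 - i) bullet)%:R
      = (i == fsize c.1)%:R * (bullets c.2)%:R :> k.
    rewrite eq_sym; case: eqP => [->|]; last by rewrite !mul0r.
    by rewrite bullets_nseq -en -ec addKn eqxx andbT.
  under eq_bigr do rewrite e2.
  have fn : nilp c.1 = (fsize c.1 == 0)%N.
    by case: (c.1) => [//|[vs] ws]; rewrite fsize_cons.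
  case: (posnP (fsize c.1)) => [e0|pos].
    rewrite fn e0 eqxx expr0 !mul1r subrr big_seq big1 // => i; rewrite mem_iota => /andP[i1 _].
    by rewrite (gtn_eqF i1) mul0r mulr0.
  have fi : fsize c.1 \in iota 1 n.+1 by rewrite mem_iota pos add1n ltnS -en -ec leq_addr.
  rewrite (bigD1_seq _ fi (iota_uniq _ _)) /= eqxx big1 => [|i /negPf->]; last by rewrite mul0r mulr0.
  rewrite fn (gtn_eqF pos) addr0 mul1r mul0r sub0r -mulNr.
  by congr (_ * _); rewrite -{2}(prednK pos) exprS mulN1r opprK.
(* Since [us] is nonempty the alternating sum is 0, and only the cut that prunes nothing remains. *)
rewrite sumrB alternating_cuts; case: (us) en => // u us' en; rewrite subr0 -en.
have -> : \sum_(i <- cuts (u :: us')) ((nilp i.1)%:R * (bullets i.2)%:R : k)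
   = \sum_(i <- cuts (u :: us') | nilp i.1) (bullets i.2)%:R.
  by rewrite [RHS]big_mkcond; apply: eq_bigr => c _; case: ifP; rewrite ?mul1r ?mul0r.
by rewrite -big_filter filter_cuts_l big_seq1.
Qed.

(** * Stripping successive layers of leaves *)

Lemma ZE_nil us : pairT (ZE k [::]) us = (nilp us)%:R.
Proof. exact: pairT_one. Qed.

Lemma ZE_cons i I us : pairT (ZE k (i :: I)) us
  = \sum_(c <- cuts us) (c.1 == nseq i bullet)%:R * pairT (ZE k I) c.2.
Proof. by rewrite /= pairT_glmul; apply: eq_bigr => c _; rewrite pairT_eps. Qed.

Lemma ZE_empty I : pairT (ZE k I) [::] = (sumn I == 0)%N%:R.
Proof.
elim: I => [|i I IH]; first by rewrite ZE_nil.
by rewrite ZE_cons big_seq1 /= IH addn_eq0 -natrM mulnb; case: i.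
Qed.

(** A part 0 strips nothing. Hence [Zstar] can be computed on exponent vectors with zeros, the form
    in which [sermul] multiplies. *)
Lemma ZE_compr I us : pairT (ZE k (compr I)) us = pairT (ZE k I) us.
Proof.
elim: I us => // -[|i] I IH us.
  rewrite ZE_cons [compr _]/= IH.
  have -> : \sum_(c <- cuts us) ((c.1 == nseq 0 bullet)%:R * pairT (ZE k I) c.2)
     = \sum_(c <- cuts us | nilp c.1) pairT (ZE k I) c.2.
    by rewrite [RHS]big_mkcond; apply: eq_bigr => -[[|? ?] ?] _; rewrite ?mul1r ?mul0r.
  by rewrite -big_filter filter_cuts_l big_seq1.
by rewrite [compr _]/= !ZE_cons; apply: eq_bigr => c _; rewrite IH.
Qed.

Lemma ZstarE us a : Zstar k us a = pairT (ZE k a) us.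
Proof. exact: ZE_compr. Qed.

(** Only [j = size c] can contribute. *)
Lemma cat_bullets (c d : seq tree) i : (c ++ d == nseq i bullet)%:R
  = \sum_(j <- iota 0 i.+1) (c == nseq j bullet)%:R * (d == nseq (i - j) bullet)%:R :> k.
Proof.
case: (boolP ((size c <= i)%N && (c == nseq (size c) bullet))) => [/andP[ci /eqP ec]|nc].
  rewrite (bigD1_seq (size c)) ?iota_uniq ?mem_iota //= -ec eqxx mul1r big1 ?addr0.
    rewrite -{1}(subnKC ci) nseqD {1}ec eqseq_cat ?size_nseq // eqxx.
    by [].
  by move=> j jc; rewrite ec; case: eqP => [/(congr1 size)|]; rewrite ?mul0r // !size_nseq => e; rewrite e eqxx in jc.
rewrite big_seq big1 => [|j]; last first.
  rewrite mem_iota ltnS => /= ji; case: eqP => [ec|]; rewrite ?mul0r //.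
  by rewrite ec size_nseq ji eqxx in nc.
case: eqP => // e; case/negP: nc.
have ci : (size c <= i)%N by rewrite -(size_nseq i bullet) -e size_cat leq_addr.
by rewrite ci -(take_nseq _ ci) -e take_size_cat ?eqxx.
Qed.

(** A layer of [i] leaves takes [j] of them from [us] and [i - j] from [vs]; the vectors of such [j]
    are the entries of [boxes a]. *)
Lemma ZE_cat a us vs :
  pairT (ZE k a) (us ++ vs) = sermul (fun b => pairT (ZE k b) us) (fun b => pairT (ZE k b) vs) a.
Proof.
rewrite /sermul; elim: a us vs => [|i a IH] us vs.
  by rewrite big_seq1 !ZE_nil -natrM mulnb /nilp size_cat addn_eq0.
rewrite ZE_cons (big_cuts_cat us vs (fun P R => (P == nseq i bullet)%:R * pairT (ZE k a) R)).
rewrite (_ : boxes _ = [seq j :: b | j <- iota 0 i.+1, b <- boxes a]) // big_allpairs_dep.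
transitivity (\sum_(c <- cuts us) \sum_(d <- cuts vs) \sum_(j <- iota 0 i.+1) \sum_(b <- boxes a)
  ((c.1 == nseq j bullet)%:R * pairT (ZE k b) c.2) *
  ((d.1 == nseq (i - j) bullet)%:R * pairT (ZE k [seq (p.1 - p.2)%N | p <- zip a b]) d.2)).
  apply: eq_bigr => c _; apply: eq_bigr => d _; rewrite cat_bullets IH big_distrl.
  apply: eq_bigr => j _; rewrite big_distrr; apply: eq_bigr => b _; exact: mulrACA.
under [LHS]eq_bigr do rewrite exchange_big.
rewrite [LHS]exchange_big; apply: eq_bigr => j _ /=.
under [LHS]eq_bigr do rewrite exchange_big.
rewrite [LHS]exchange_big; apply: eq_bigr => b _ /=.
rewrite !ZE_cons big_distrl; apply: eq_bigr => c _.
by rewrite big_distrr.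
Qed.

(** As parts are positive, the root must survive until the last layer, which then consists of the
    root alone. *)
Lemma ZE_Bplus I j us : all (leq 1) (rcons I j) ->
  pairT (ZE k (rcons I j)) [:: Node us] = (j == 1)%N%:R * pairT (ZE k I) us.
Proof.
elim: I us => [|i I IH] us pos.
  (* A single layer must exhaust the tree: keeping the root contributes 0, and cutting it requires
     [us] empty and [j = 1]. *)
  rewrite ZE_cons cuts_cons big_cat big_map big_allpairs_dep big_seq1 /= big1 ?addr0.
    rewrite pairT_one mulr1 pairT_one -natrM mulnb; case: j {pos} => [|[|j]] //=.
      by case: us => [|t us]; rewrite ?eqxx //; case: eqP.
    by case: eqP.
  by move=> c _; rewrite big_seq1 pairT_one mulr0.
have posI : all (leq 1) (rcons I j) by case/andP: pos.
rewrite rcons_cons !ZE_cons cuts_cons big_cat big_map big_allpairs_dep big_seq1 /=.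
(* Cutting the root now leaves an empty trunk, which pairs to 0 with the remaining parts because [j]
   is positive. *)
rewrite ZE_empty sumn_rcons addn_eq0 andbC.
have -> : (j == 0)%N = false by move: posI; rewrite all_rcons => /andP[]; case: (j).
rewrite mulr0 add0r big_distrr; apply: eq_bigr => c _.
by rewrite big_seq1 /= cats0 IH // mulrCA.
Qed.

Lemma Zstar_Bplus us a : Zstar k [:: Node us] a = alpha (Zstar k us) a.
Proof.
rewrite /alpha {1}/Zstar; have : all (leq 1) (compr a) by exact: filter_all.
case/lastP: (compr a) => [_|I j pos] /=.
  (* For the empty composition the default [0] of [last] makes [alpha] vanish, as does the pairing
     of the unit with a nonempty forest. *)
  by rewrite -/(ZE k [::]) ZE_nil.
rewrite last_rcons ZE_Bplus // size_rcons /= -cats1 take_size_cat // ZstarE.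
by case: eqP => _; rewrite ?mul1r ?mul0r.
Qed.

Lemma Zstar_cat us vs a : Zstar k (us ++ vs) a = sermul (Zstar k us) (Zstar k vs) a.
Proof. by rewrite ZstarE ZE_cat; apply: eq_bigr => b _; rewrite !ZstarE. Qed.

Lemma Zstar_nil a : Zstar k [::] a = ser1 k a.
Proof. by rewrite ZstarE ZE_empty. Qed.

End CharZero.

Theorem theorem4p2 (k : fieldType) (hk : [pchar k] =i pred0) :
  (forall (u : seq tree) (a : seq nat),
      Zstar k [:: Node u] a = alpha (Zstar k u) a) /\
  (forall f : seq tree -> series k,
      (forall u, is_qsym (f u)) ->
      (forall u v a, iso (Node u) (Node v) -> f u a = f v a) ->
      (forall a, f [::] a = ser1 k a) ->
      (forall u v a, f (u ++ v) a = sermul (f u) (f v) a) ->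
      (forall u a, f [:: Node u] a = alpha (f u) a) ->
      forall u a, f u a = Zstar k u a).
Proof.
split=> [u a|f _ _ f1 fM fB u]; first exact: Zstar_Bplus.
elim/forest_ind: u => [|us vs IHu IHv] a; first by rewrite f1 Zstar_nil.
(* The forest is the product of $B_+$ of [us] with [vs]; both factors are covered by the induction
   hypotheses. *)
rewrite -cat1s fM Zstar_cat //; apply: eq_bigr => b _; rewrite IHv fB Zstar_Bplus //.
by rewrite /alpha IHu.
Qed.
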